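(* Let $\mathcal N=\{n_i\}_{i=0}^\infty$ be an increasing sequence of integers such that $\lim_{i\to\infty}\frac{n_{i+1}-n_i}{n_{i+2}-n_{i+1}}=0$, and let $\mathcal I(\mathcal N)=\left\{A\subseteq\mathbb N:\lim_{i\to\infty}\frac{|A\cap[n_i,n_{i+1})|}{n_{i+1}-n_i}=0\right\}$. Then $A(\mathcal I(\mathcal N))=2^{\aleph_0}$.
   Context: $\mathbb S$ is the symmetric group of $\mathbb N$. For an ideal $\mathcal I$ on $\mathbb N$, $\mathbb S(\mathcal I)$ is the subgroup of permutations $\pi$ with $\pi(A)\in\mathcal I\iff A\in\mathcal I$ for all $A\subseteq\mathbb N$, and $\mathbb F(\mathcal I)$ is the normal subgroup of those $\pi\in\mathbb S(\mathcal I)$ whose support $\{x:\pi(x)\ne x\}$ belongs to $\mathcal I$. For a group $G$, $A(G)$ is the least uncountable cardinal $\kappa$ such that $G$ has a maximal Abelian subgroup of cardinality $\kappa$, and $A(\mathcal I)=A(\mathbb S(\mathcal I)/\mathbb F(\mathcal I))$. *)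

(* Defs.v *)
From HB Require Import structures.
From mathcomp Require Import all_boot all_order all_algebra.
From mathcomp Require Import finmap.
From mathcomp Require Import all_classical all_reals all_analysis.

Set Implicit Arguments.
Unset Strict Implicit.
Unset Printing Implicit Defensive.

Import Order.TTheory GRing.Theory Num.Theory numFieldNormedType.Exports.

Local Open Scope classical_set_scope.

Record normalSubgroup (G : groupType) := NormalSubgroup {
  nsub_set :> G -> Prop;
  nsub1 : nsub_set 1%g;
  nsubM : forall x y, nsub_set x -> nsub_set y -> nsub_set (x * y)%g;
  nsubV : forall x, nsub_set x -> nsub_set (x^-1)%g;
  nsubJ : forall x g, nsub_set x -> nsub_set (x ^ g)%g
}.

Section QuotientGroup.
Variables (G : groupType) (N : normalSubgroup G).
Local Open Scope group_scope.
Local Open Scope quotient_scope.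

Definition coset_rel (x y : G) : bool := `[< N (x^-1 * y) >].

Lemma coset_rel_is_equiv : equiv_class_of coset_rel.
Proof.
split=> [x|x y|y x z].
- by apply/asboolP; rewrite mulVg; exact: nsub1.
- by apply: asbool_equiv_eq; split=> /nsubV; rewrite invgM invgK.
- move=> /asboolP Nxy /asboolP Nyz; apply/asboolP.
  by have := nsubM Nxy Nyz; rewrite mulgA mulgK.
Qed.

Canonical coset_equiv := EquivRelPack coset_rel_is_equiv.
Canonical coset_encModRel := defaultEncModRel coset_rel.

Definition quotient_group := {eq_quot coset_rel}.

HB.instance Definition _ := Choice.on quotient_group.
HB.instance Definition _ := EqQuotient.on quotient_group.

Lemma eq_cosetP (x y : G) :
  \pi_quotient_group x = \pi_quotient_group y <-> N (x^-1 * y).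
Proof. by split=> [/eqmodP/asboolP//|Nxy]; apply/eqmodP/asboolP. Qed.

Definition quot_one : quotient_group := \pi_quotient_group 1.
Definition quot_mul := lift_op2 quotient_group ( *%g : G -> G -> G).
Definition quot_inv := lift_op1 quotient_group (fun x : G => x^-1).

Lemma repr_cosetP (x : G) : N ((repr (\pi_quotient_group x))^-1 * x).
Proof. by apply/eq_cosetP; rewrite reprK. Qed.

Lemma quot_mul_pi (x y : G) :
  quot_mul (\pi_quotient_group x) (\pi_quotient_group y)
  = \pi_quotient_group (x * y).
Proof.
unlock quot_mul; apply/eq_cosetP.
have Nx := repr_cosetP x; have Ny := repr_cosetP y.
set x' := repr _ in Nx *; set y' := repr _ in Ny *.
have -> : (x' * y')^-1 * (x * y) = (x'^-1 * x) ^ y' * (y'^-1 * y).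
  by rewrite conjgE invgM !mulgA mulgK.
by apply: nsubM => //; exact: nsubJ.
Qed.

Lemma quot_inv_pi (x : G) :
  quot_inv (\pi_quotient_group x) = \pi_quotient_group x^-1.
Proof.
unlock quot_inv; apply/eq_cosetP; have /nsubV/(nsubJ x^-1) := repr_cosetP x.
by rewrite conjgE !invgM !invgK !mulgA mulgV mul1g.
Qed.

Lemma quot_mulA : associative quot_mul.
Proof.
by move=> x y z; rewrite -[x]reprK -[y]reprK -[z]reprK !quot_mul_pi mulgA.
Qed.

Lemma quot_mul1g : left_id quot_one quot_mul.
Proof. by move=> x; rewrite -[x]reprK quot_mul_pi mul1g. Qed.

Lemma quot_mulg1 : right_id quot_one quot_mul.
Proof. by move=> x; rewrite -[x]reprK quot_mul_pi mulg1. Qed.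

Lemma quot_mulVg : left_inverse quot_one quot_inv quot_mul.
Proof. by move=> x; rewrite -[x]reprK quot_inv_pi quot_mul_pi mulVg. Qed.

Lemma quot_mulgV : right_inverse quot_one quot_inv quot_mul.
Proof. by move=> x; rewrite -[x]reprK quot_inv_pi quot_mul_pi mulgV. Qed.

HB.instance Definition _ := isGroup.Build quotient_group
  quot_mulA quot_mul1g quot_mulg1 quot_mulVg quot_mulgV.

Lemma pi_mulg (x y : G) :
  \pi_quotient_group (x * y) = \pi_quotient_group x * \pi_quotient_group y
    :> quotient_group.
Proof. exact/esym/quot_mul_pi. Qed.

End QuotientGroup.

Section AbelianNumber.
Local Open Scope group_scope.
Local Open Scope card_scope.
Variable G : groupType.

Definition abelian_subgroup (H : set G) :=
  group_closed [in H] /\ {in H &, forall x y, commute x y}.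

Definition maximal_abelian_subgroup (H : set G) :=
  abelian_subgroup H /\
  forall K : set G, abelian_subgroup K -> H `<=` K -> K = H.

Definition has_maximal_abelian_subgroup_of_card (T : Type) (k : set T) :=
  exists2 H : set G, maximal_abelian_subgroup H & H #= k.

(* Cardinals are represented by sets, so "A(G) = |k|" is a relation between G
   and k; it includes the existence of the least cardinal defining A(G). *)
Definition abelian_number_eq (T : Type) (k : set T) :=
  [/\ ~ countable k,
      has_maximal_abelian_subgroup_of_card k &
      forall (U : Type) (l : set U), ~ countable l ->
        has_maximal_abelian_subgroup_of_card l -> k #<= l].

End AbelianNumber.

Section SymmetricGroup.
Variable T : choiceType.

Record Sym := MkSym { perm_fun :> T -> T; _ : `[< bijective perm_fun >] }.

HB.instance Definition _ := [isSub for perm_fun].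
HB.instance Definition _ := [Choice of Sym by <:].

Lemma Sym_bij (p : Sym) : bijective p.
Proof. exact/asboolP/(valP p). Qed.

Lemma SymP (p q : Sym) : p =1 q -> p = q.
Proof. by move=> pq; apply/val_inj/funext. Qed.

Definition mkSym (f : T -> T) (bf : bijective f) : Sym :=
  MkSym (introT (asboolP _) bf).

Definition Sym_one : Sym := mkSym (Bijective (frefl id) (frefl id)).

Definition Sym_mul (p q : Sym) : Sym := mkSym (bij_comp (Sym_bij p) (Sym_bij q)).

Lemma Sym_inv_ex (p : Sym) : exists g, cancel p g /\ cancel g p.
Proof. by have [g pK gK] := Sym_bij p; exists g. Qed.

Definition Sym_inv_fun (p : Sym) : T -> T := projT1 (cid (Sym_inv_ex p)).

Lemma Sym_invK (p : Sym) : cancel p (Sym_inv_fun p).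
Proof. by rewrite /Sym_inv_fun; case: cid => g []. Qed.

Lemma Sym_invVK (p : Sym) : cancel (Sym_inv_fun p) p.
Proof. by rewrite /Sym_inv_fun; case: cid => g []. Qed.

Definition Sym_inv (p : Sym) : Sym := mkSym (Bijective (Sym_invVK p) (Sym_invK p)).

Lemma Sym_mulA : associative Sym_mul. Proof. by move=> p q r; exact: SymP. Qed.
Lemma Sym_mul1g : left_id Sym_one Sym_mul. Proof. by move=> p; exact: SymP. Qed.
Lemma Sym_mulg1 : right_id Sym_one Sym_mul. Proof. by move=> p; exact: SymP. Qed.
Lemma Sym_mulVg : left_inverse Sym_one Sym_inv Sym_mul.
Proof. by move=> p; apply: SymP => x; exact: Sym_invK. Qed.
Lemma Sym_mulgV : right_inverse Sym_one Sym_inv Sym_mul.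
Proof. by move=> p; apply: SymP => x; exact: Sym_invVK. Qed.

HB.instance Definition _ := isGroup.Build Sym
  Sym_mulA Sym_mul1g Sym_mulg1 Sym_mulVg Sym_mulgV.

Lemma Sym1E x : (1%g : Sym) x = x. Proof. by []. Qed.
Lemma SymME (p q : Sym) x : (p * q)%g x = p (q x). Proof. by []. Qed.
Lemma SymK (p : Sym) : cancel p (p^-1)%g. Proof. exact: Sym_invK. Qed.
Lemma SymVK (p : Sym) : cancel (p^-1)%g p. Proof. exact: Sym_invVK. Qed.

Definition support (p : Sym) : set T := [set x | p x <> x].

End SymmetricGroup.

Record ideal (T : Type) := Ideal {
  ideal_sets :> set T -> Prop;
  ideal0 : ideal_sets set0;
  idealU : forall A B, ideal_sets A -> ideal_sets B -> ideal_sets (A `|` B);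
  idealS : forall A B, A `<=` B -> ideal_sets B -> ideal_sets A
}.

Section IdealGroups.
Variables (T : choiceType) (I : ideal T).
Local Open Scope group_scope.

Definition preserves (p : Sym T) := forall A : set T, I (p @` A) <-> I A.

Definition in_SymI (p : Sym T) : bool := `[< preserves p >].

Lemma in_SymI_closed : group_closed in_SymI.
Proof.
split=> [|p q /asboolP Ip /asboolP Iq]; apply/asboolP => A.
  by rewrite (_ : _ @` A = A)//; exact: image_id.
have pqE : (p / q)%g @` A = p @` ((q^-1)%g @` A) by rewrite image_comp.
have qVK : q @` ((q^-1)%g @` A) = A.
  rewrite image_comp -[RHS]image_id; congr (_ @` _).
  by apply/funext => x /=; rewrite SymVK.
by rewrite pqE Ip -Iq qVK.
Qed.

Record SymI := MkSymI { SymI_perm :> Sym T; _ : in_SymI SymI_perm }.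

HB.instance Definition _ := [isSub for SymI_perm].
HB.instance Definition _ := [Choice of SymI by <:].
HB.instance Definition _ :=
  SubChoice_isSubGroup.Build (Sym T) in_SymI SymI in_SymI_closed.

Lemma SymI1 : SymI_perm 1 = 1. Proof. by apply: SymP. Qed.
Lemma SymIM (p q : SymI) : SymI_perm (p * q) = SymI_perm p * SymI_perm q.
Proof. by apply: SymP. Qed.
Lemma SymIV (p : SymI) : SymI_perm p^-1 = (SymI_perm p)^-1.
Proof. by apply: SymP. Qed.

Definition FinI_set : set SymI := [set p : SymI | I (support p)].

Lemma FinI1 : FinI_set 1.
Proof. by apply: (idealS _ (ideal0 I)) => x; apply. Qed.

Lemma FinIM (p q : SymI) : FinI_set p -> FinI_set q -> FinI_set (p * q).
Proof.
move=> Ip Iq; apply: (idealS _ (idealU Ip Iq)) => x.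
rewrite /support SymIM /= => pqx.
by have [qx|/eqP qx] := eqVneq (q x) x; [left; rewrite qx in pqx|right].
Qed.

Lemma FinIV (p : SymI) : FinI_set p -> FinI_set p^-1.
Proof.
apply: idealS => x; rewrite /support SymIV /= => + px; apply.
by rewrite -[in LHS]px; exact: SymK.
Qed.

Lemma FinIJ (p g : SymI) : FinI_set p -> FinI_set (p ^ g).
Proof.
rewrite /FinI_set/= => Ip; have /asboolP Ig := valP g.
apply/Ig; apply: (idealS _ Ip) => _ [x + <-].
rewrite /support /= => + pgx; apply.
by rewrite pgx; exact: SymK.
Qed.

Definition FinI : normalSubgroup SymI := NormalSubgroup FinI1 FinIM FinIV FinIJ.

Definition ideal_abelian_number_eq (U : Type) (k : set U) :=
  abelian_number_eq (quotient_group FinI) k.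

End IdealGroups.

Section IntervalIdeal.
Variables (R : realType) (n : nat -> int).
Local Open Scope ring_scope.

Definition in_interval (A : set nat) (i : nat) : set nat :=
  A `&` [set k | n i <= k%:Z < n i.+1].

Definition interval_density (A : set nat) (i : nat) : R :=
  #|` fset_set (in_interval A i)|%:R / (n i.+1 - n i)%:~R.

Definition interval_null : set (set nat) :=
  [set A | interval_density A i @[i --> \oo] --> (0 : R)].

Lemma in_interval_finite A i : finite_set (in_interval A i).
Proof.
apply: (sub_finite_set _ (finite_II `|n i.+1|%N)) => k /= [_ /andP[_ kn]].
by rewrite -ltz_nat; apply: lt_le_trans kn _; rewrite abszE ler_norm.
Qed.

Lemma interval_null0 : interval_null set0.
Proof.
rewrite /interval_null/= /interval_density/in_interval.
under eq_fun do rewrite set0I fset_set0 cardfs0 mul0r.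
exact: cvg_cst.
Qed.

Lemma interval_density_norm A i : `|interval_density A i| =
  #|` fset_set (in_interval A i)|%:R * `|(n i.+1 - n i)%:~R^-1|.
Proof. by rewrite normrM normr_nat. Qed.

Lemma interval_nullU A B :
  interval_null A -> interval_null B -> interval_null (A `|` B).
Proof.
rewrite /interval_null/= => A0 B0; apply/norm_cvg0P.
have AB0 : `|interval_density A i| + `|interval_density B i| @[i --> \oo]
    --> (0 : R).
  by rewrite -[0]addr0; apply: cvgD; exact/norm_cvg0P.
apply: (squeeze_cvgr _ (cvg_cst 0) AB0); near=> i; rewrite normr_ge0/=.
rewrite !interval_density_norm -mulrDl ler_wpM2r// -natrD ler_nat.
rewrite /in_interval setIUl fset_setU; [|exact: in_interval_finite..].
by rewrite cardfsU leq_subr.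
Unshelve. all: by end_near. Qed.

Lemma interval_nullS A B : A `<=` B -> interval_null B -> interval_null A.
Proof.
rewrite /interval_null/= => AB B0; apply/norm_cvg0P.
have nB0 : `|interval_density B i| @[i --> \oo] --> (0 : R).
  exact/norm_cvg0P.
apply: (squeeze_cvgr _ (cvg_cst 0) nB0); near=> i; rewrite normr_ge0/=.
rewrite !interval_density_norm ler_wpM2r// ler_nat.
apply: fsubset_leq_card; rewrite -fset_set_sub; [|exact: in_interval_finite..].
exact: setSI.
Unshelve. all: by end_near. Qed.

Definition interval_ideal : ideal nat :=
  Ideal interval_null0 interval_nullU interval_nullS.

End IntervalIdeal.

(* Main.v *)
Require Import Defs.
From mathcomp Require Import all_boot all_order all_algebra.
From mathcomp Require Import lra zify.
From mathcomp Require Import all_classical all_reals all_analysis.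
Import Order.TTheory GRing.Theory Num.Theory numFieldNormedType.Exports.
Local Open Scope classical_set_scope.
Local Open Scope ring_scope.

Set Implicit Arguments.
Unset Strict Implicit.
Unset Printing Implicit Defensive.

(* Call [X] almost invariant if [X \ p^-1(X)] is in the ideal for every [p] in
   S(I). If [h] represents an element of a maximal Abelian subgroup [H] and [X]
   is almost invariant, a permutation acting as [h] on [X] and as the identity
   elsewhere (modulo the ideal) commutes with everything [h] commutes with, so
   its class is in [H]. Since the interval lengths grow faster than any
   geometric sequence, unions of intervals are almost invariant: few points
   lie below a given interval, hence few points move to a lower interval, and
   the image of the points moving to a higher interval is sparse. If [h] is
   nontrivial it moves a fixed proportion of infinitely many intervals, and
   restricting it to unions of those gives 2^aleph_0 elements of [H]. So every
   nontrivial maximal Abelian subgroup has cardinality 2^aleph_0; one exists by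
   Zorn's lemma, because swapping [2k] and [2k+1] for all [k] defines a
   nontrivial element. *)

Local Open Scope card_scope.

(** * Centralizers and maximal Abelian subgroups of a group *)

Section MaximalAbelian.
Local Open Scope group_scope.
Variable G : groupType.
Implicit Types (A H : set G) (x y : G).

Definition cent A : set G := [set x | forall y, A y -> commute x y].

Lemma cent_group_closed A : group_closed [in cent A].
Proof.
split=> [|x y]; first by rewrite inE => y _; exact/commute_sym/commute1.
rewrite !inE => xA yA z Az.
apply/commute_sym/commuteM; first exact/commute_sym/xA.
exact/commuteV/commute_sym/yA.
Qed.

(** Centralizers reverse inclusion, so the bicentralizer lies in [cent A], all of which it commutes
    with. *)
Lemma bicent_abelian A : A `<=` cent A -> abelian_subgroup (cent (cent A)).
Proof.
move=> Ac; split; first exact: cent_group_closed.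
move=> x y; rewrite !inE => xA yA; apply: xA => z Az; apply: yA; exact: Ac.
Qed.

Lemma sub_bicent A : A `<=` cent (cent A).
Proof. by move=> x Ax y yA; exact/commute_sym/yA. Qed.

Lemma abelian_sub_cent H : abelian_subgroup H -> H `<=` cent H.
Proof. by move=> [_ Hc] x Hx y Hy; apply: Hc; rewrite inE. Qed.

(** Adjoining [x] to [H] keeps it commutative; the bicentralizer of the result is Abelian and
    contains [H], so it is [H]. *)
Lemma maximal_abelian_cent H : maximal_abelian_subgroup H -> cent H `<=` H.
Proof.
move=> [abH maxH] x xH.
have xHc : (x |` H) `<=` cent (x |` H).
  move=> y yH z [->|Hz]; case: yH => [->|Hy] //; last first.
  - exact: abelian_sub_cent Hz.
  - exact: xH.
  - exact/commute_sym/xH.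
rewrite -(maxH _ (bicent_abelian xHc)); first by apply: sub_bicent; left.
by apply: subset_trans (@sub_bicent _) => y; right.
Qed.

Lemma maximal_abelian_exists x :
  exists2 H : set G, maximal_abelian_subgroup H & H x.
Proof.
have [|M [Mx maxM]] := @Zorn_bigcup G [set A | x |` A `<=` cent (x |` A)].
  move=> F FP Ftot y yF z zF.
  (* The alternative [A = set0] serves [y = z = x], where no member of the chain is at hand. *)
  have [A [FA Ay Az]] : exists A, [/\ F A \/ A = set0, (x |` A) y & (x |` A) z].
    case: yF zF => [->|[A FA Ay]] [->|[B FB Bz]].
    - by exists set0; split; [right|left|left].
    - by exists B; split; [left|left|right].
    - by exists A; split; [left|right|left].
    - have [AB|BA] := Ftot _ _ FA FB.
        by exists B; split; [left|right; exact: AB|right].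
      by exists A; split; [left|right|right; exact: BA].
  case: FA => [/FP|A0]; first by apply.
  by move: Ay Az; rewrite A0 setU0 => -> ->.
have abK := bicent_abelian Mx; set K := cent _ in abK.
have maxM' L : abelian_subgroup L -> x |` M `<=` L -> L = M.
  move=> abL xML; apply: contrapT => LM; apply: (maxM L).
    split; last first.
      move=> LsM; apply: LM; apply/seteqP; split => // y My.
      by apply: xML; right.
    by move=> y My; apply: xML; right.
  rewrite /= (_ : x |` L = L); last by apply/setUidr => _ ->; apply: xML; left.
  exact: abelian_sub_cent.
have KM : K = M by apply: maxM' => //; exact: sub_bicent.
have Mx' : M x by rewrite -KM; apply: sub_bicent; left.
exists M => //; split=> [|L abL ML]; first by rewrite -KM.
by apply: maxM' => // y [->|]; exact: ML.
Qed.

End MaximalAbelian.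

(** Cantor's diagonal argument. *)
Lemma set_nat_uncountable : ~ countable [set: set nat].
Proof.
move=> /countable_injP[f finj].
pose D := [set k | exists A, f A = k /\ ~ A k].
have [DfD|nDfD] := pselect (D (f D)); last by apply: (nDfD); exists D.
have [A [/finj]] := DfD; rewrite !inE => /(_ I I) -> ; exact.
Qed.

(** * Permutations modulo an arbitrary ideal *)

Section QuotientByFinI.
Variable I : ideal nat.
Local Open Scope group_scope.
Local Open Scope quotient_scope.

Local Notation G := (quotient_group (FinI I)).

Lemma ideal_image (p : SymI I) A : I A -> I (p @` A).
Proof. by have /asboolP Ip := valP p; move/Ip. Qed.

Lemma ideal_preimage (p : SymI I) A : I A -> I (p @^-1` A).
Proof.
have /asboolP Ip := valP p; move=> IA; apply/Ip; apply: idealS IA.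
exact: image_preimage_subset.
Qed.

Lemma pi_SymI_eq (p q : SymI I) :
  \pi_G p = \pi_G q <-> I [set x | p x <> q x].
Proof.
rewrite eq_cosetP /= /FinI_set /=.
suff -> : Defs.support (p^-1 * q : SymI I) = [set x | p x <> q x] by [].
apply/seteqP; split => x /=; rewrite /Defs.support /= => npq pq; apply: npq.
  by rewrite -pq; exact: Sym_invK.
by rewrite -[in LHS]pq; exact: Sym_invVK.
Qed.

Lemma commute_pi_SymI (p q : SymI I) :
  commute (\pi_G p) (\pi_G q) <-> I [set x | p (q x) <> q (p x)].
Proof.
rewrite /commute -!pi_mulg pi_SymI_eq.
by [].
Qed.

(** A class is coded by the graph of a chosen representative, a set of coded pairs. *)
Lemma card_quotient_SymI : [set: G] #<= [set: set nat].
Proof.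
pose graph (c : G) : set nat :=
  [set k | exists x : nat, k = choice.pickle (x, (repr c : SymI I) x : nat)].
apply/pcard_injP; exists graph => c d _ _ cd.
rewrite -[c]reprK -[d]reprK; congr (\pi_G _); apply/val_inj/SymP => x.
have : graph c (choice.pickle (x : nat, (repr c : SymI I) x : nat)) by exists x.
by rewrite cd => -[y /(pcan_inj choice.pickleK)[<-]].
Qed.

(* An injection defined off an ideal set [U] extends to a permutation provided
   the complements of its domain and of its range are equipotent; enlarging
   both by an infinite member [Z] of the ideal ensures this. *)
Lemma SymI_restrict (h : SymI I) (X Z : set nat) :
    I (X `\` h @^-1` X) -> I (X `\` h @` X) ->
    infinite_set Z -> I Z -> Z `&` X = set0 ->
  exists f : SymI I, I [set x | f x <> if x \in X then h x else x].
Proof.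
move=> IX1 IX2 infZ IZ ZX.
have ZXF x : Z x -> X x -> False by move=> Zx Xx; rewrite -[False]/(set0 x) -ZX.
pose q x := if x \in X then h x else x.
pose U := (X `\` h @^-1` X) `|` Z.
pose V := ~` (q @` ~` U).
have IU : I U by exact: idealU.
have hinj : injective h by apply: (can_inj (SymK h)).
have qinj : {in ~` U &, injective q}.
  (* A collision of the two branches of [q] needs a point of [X] that [h] sends out of [X]; these
     lie in [U]. *)
  have key x y : X x -> ~ X y -> ~ U x -> h x <> y.
    move=> Xx nXy nUx hxy; apply: nUx; left; split=> //.
    by rewrite /preimage/= hxy.
  move=> x y; rewrite !inE /q => nUx nUy.
  case: ifPn; case: ifPn; rewrite !(inE, notin_setE).
  - by move=> _ _ /hinj.
  - by move=> nXy Xx /(key _ _ Xx nXy nUx).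
  - by move=> Xy nXx /esym/(key _ _ Xy nXx nUy).
  - by [].
have VX : V `<=` (X `\` h @` X) `|` Z.
  move=> y Vy; have [Xy|nXy] := pselect (X y); last first.
    right; apply: contrapT => nZy; apply: Vy; exists y; last first.
      by rewrite /q memNset.
    by move=> [[]|].
  left; split=> // -[x Xx hxy]; apply: Vy; exists x; last by rewrite /q mem_set.
  by case=> [[_]|/ZXF]; [rewrite /preimage/= hxy|exact].
have IV : I V by apply: idealS VX _; exact: idealU.
have ZV : Z `<=` V.
  move=> z Zz [x nUx]; rewrite /q; case: ifPn; rewrite ?(inE, notin_setE).
    move=> Xx hxz; apply: nUx; left; split=> //; rewrite /preimage /= hxz.
    exact: ZXF.
  by move=> _ xz; apply: nUx; right; rewrite xz.
have UV : [set: nat] `\` ~` U #= [set: nat] `\` (q @` ~` U).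
  rewrite !setTD setCK; apply: (@card_eq_trans _ _ _ _ [set: nat]).
    apply: eq_card_nat => //; apply: sub_infinite_set infZ; exact: subsetUr.
  apply/card_esym/eq_card_nat => //; exact: sub_infinite_set infZ.
have qbij : set_bij (~` U) (q @` ~` U) q.
  by split=> // x Ux; exists x.
have [q' q'E] := Pbij qbij.
have [g gE] := super_bij q' (@subsetT _ _) (@subsetT _ _) UV.
have gq x : ~ U x -> g x = q x.
  by move=> nUx; rewrite gE ?inE// -q'E.
(* Off [U], [g] is [h] or the identity, which both respect the ideal; the rest is absorbed by [V]
   for images and by [U] for preimages. *)
have g_in : in_SymI I (mkSym (bijTT : bijective g)).
  apply/asboolP => A; split=> IA; last first.
    apply: idealS (idealU (idealU (ideal_image h IA) IA) IV) => _ [x Ax <-].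
    have [Ux|/gq gxE] := pselect (U x).
      right=> -[y nUy]; rewrite -gq// => gyx; apply: nUy.
      by rewrite (bij_inj (bijTT : bijective g) gyx).
    left; rewrite /= gxE /q; case: ifPn => _; last by right.
    by left; exists x.
  apply: idealS (idealU (idealU (ideal_preimage h IA) IA) IU) => x Ax.
  have [Ux|/gq gxE] := pselect (U x); [by right|left].
  have : q x = h x \/ q x = x by rewrite /q; case: ifP; [left|right].
  by rewrite -gxE => -[gx|gx]; [left|right]; exists x.
exists (MkSymI g_in); apply: idealS IU => x /= gx.
by apply: contrapT => /gq.
Qed.

Definition almost_invariant (X : set nat) :=
  forall p : SymI I, I (X `\` p @^-1` X).

Lemma almost_invariant_image X (p : SymI I) :
  almost_invariant X -> I (X `\` p @` X).
Proof.
move=> /(_ p^-1); apply: idealS => x [Xx nXx]; split=> // Xpx; apply: nXx.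
by exists (p^-1 x) => //; exact: Sym_invVK.
Qed.

Lemma almost_invariant_preimage X (p : SymI I) :
  almost_invariant X -> I (p @^-1` X `\` X).
Proof.
move=> /(@almost_invariant_image X p)/(@ideal_preimage p).
apply: idealS => x [Xpx nXx]; split=> //= -[y Xy].
by move=> /(can_inj (@Sym_invK _ p)) yx; apply: nXx; rewrite -yx.
Qed.

(** Off an ideal set, [x] and [k x] are both in [X] or both outside, so [f] acts on them by the same
    branch. *)
Lemma commute_restrict (h f k : SymI I) X : almost_invariant X ->
    I [set x | f x <> if x \in X then h x else x] ->
  commute (\pi_G k) (\pi_G h) -> commute (\pi_G k) (\pi_G f).
Proof.
move=> aX IE /commute_pi_SymI Ikh; apply/commute_pi_SymI.
pose E := [set x | f x <> if x \in X then h x else x].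
have IU := idealU (idealU (idealU (ideal_preimage k IE) IE)
  (idealU (aX k) (almost_invariant_preimage k aX))) Ikh.
apply: idealS IU => x /= kfx; apply: contrapT => /not_orP[/not_orP[]].
move=> /not_orP[/contrapT fkx /contrapT fx] /not_orP[nX nX'] /contrapT khx.
apply: kfx; rewrite fx fkx; case: ifPn; rewrite !(inE, notin_setE) => Xx.
  rewrite mem_set//; apply: contrapT => nXk; exact: nX.
by rewrite memNset// => Xk; exact: nX'.
Qed.

(** Each [S] gives the restriction of [h] to [X S]. Its class centralizes [H], hence is in [H]; for
    different [S] the classes differ, since one restriction moves a non-ideal set that the other
    fixes modulo the ideal. *)
Lemma card_maximal_abelian (h : SymI I) (H : set G) (X : set nat -> set nat)
    (Z : set nat) :
    maximal_abelian_subgroup H -> H (\pi_G h) ->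
    infinite_set Z -> I Z -> (forall S, Z `&` X S = set0) ->
    (forall S, almost_invariant (X S)) ->
    (forall S S', ~ S `<=` S' ->
       ~ I ((X S `\` X S') `&` Defs.support h)) ->
  [set: set nat] #<= H.
Proof.
move=> maxH Hh infZ IZ ZX aX XS.
have fP S : exists f : SymI I, I [set x | f x <> if x \in X S then h x else x].
  apply: SymI_restrict (ZX S) => //; first exact: aX.
  exact/almost_invariant_image/aX.
pose f S := projT1 (cid (fP S)).
have fE S : I [set x | f S x <> if x \in X S then h x else x].
  by rewrite /f; case: cid.
have f_sub S S' : \pi_G (f S) = \pi_G (f S') -> S `<=` S'.
  move=> /pi_SymI_eq ff; apply: contrapT => /XS; apply.
  apply: idealS (idealU (idealU (fE S) (fE S')) ff) => x [[XSx nXS'x] hx].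
  apply: contrapT => /not_orP[/not_orP[/contrapT fx /contrapT f'x]] /contrapT.
  by rewrite fx f'x mem_set// memNset.
have finj : injective (fun S => \pi_G (f S)).
  by move=> S S' ff; apply/seteqP; split; exact: f_sub.
have fH : range (fun S => \pi_G (f S)) `<=` H.
  move=> _ [S _ <-]; apply: maximal_abelian_cent => // c Hc.
  rewrite -[c]reprK; apply/commute_sym/commute_restrict; [exact: aX|exact: fE|].
  rewrite reprK; have [[_ abH] _] := maxH; apply: abH; exact: mem_set.
apply: card_le_trans (subset_card_le fH).
by rewrite (card_le_eqr (inj_card_eq _)) // => x y _ _; exact: finj.
Qed.

End QuotientByFinI.

(** * Convergence to zero of real sequences *)

Section NullSequences.
Variable R : realType.
Implicit Types s q : R^nat.

Lemma cvg0P s : (forall i, 0 <= s i) ->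
  s @ \oo --> 0 <->
  forall e, 0 < e -> exists N, forall i, (N <= i)%N -> s i < e.
Proof.
move=> s_ge0; split=> [/cvgrPdist_lt s0 e /s0[N _ sN]|s0].
  exists N => i /sN; rewrite /= sub0r normrN ger0_norm//.
apply/cvgrPdist_lt => e /s0[N sN]; exists N => // i /sN.
by rewrite /= sub0r normrN ger0_norm.
Qed.

(** Once [q] stays below 1/2, a bound [M >= 1] on [s] persists because [(M + 1) / 2 <= M]; then
    [s i.+1] is at most [(M + 1) * q i]. *)
Lemma cvg0_contract s q : (forall i, 0 <= s i) -> (forall i, 0 <= q i) ->
  (forall i, s i.+1 <= (s i + 1) * q i) -> q @ \oo --> 0 -> s @ \oo --> 0.
Proof.
move=> s_ge0 q_ge0 sq /cvg0P-/(_ q_ge0) q0; apply/cvg0P => // e e0.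
have [N qN] := q0 2^-1 ltac:(by rewrite invr_gt0).
pose M := s N + 1.
have M1 : 1 <= M by rewrite /M lerDr.
have sM i : s (N + i)%N <= M.
  elim: i => [|i IH]; first by rewrite addn0 /M lerDl.
  rewrite addnS; apply: le_trans (sq _) _.
  have := qN (N + i)%N (leq_addr _ _); have := q_ge0 (N + i)%N.
  have := s_ge0 (N + i)%N; nra.
have [N' qN'] := q0 (e / (M + 1)) ltac:(by apply: divr_gt0 => //; lra).
exists (N + N').+1 => -[//|i]; rewrite ltnS => Ni.
apply: le_lt_trans (sq _) _.
have /qN' : (N' <= i)%N by apply: leq_trans Ni; exact: leq_addl.
rewrite ltr_pdivlMr; last by lra.
have := sM (i - N)%N; rewrite subnKC; last by apply: leq_trans Ni; exact: leq_addr.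
have := q_ge0 i; nra.
Qed.

End NullSequences.

(** * The interval ideal *)

Section IntervalNull.
Variables (R : realType) (n : nat -> int).
Hypothesis n_incr : {homo n : i j / (i < j)%N >-> i < j}.
Hypothesis n_lim :
  ((n i.+1 - n i)%:~R / (n i.+2 - n i.+1)%:~R : R) @[i --> \oo] --> (0 : R).

Local Notation I := (interval_ideal R n).
Local Notation len i := (n i.+1 - n i).

Lemma n_mono : {mono n : i j / (i <= j)%N >-> i <= j}.
Proof. exact: (@le_mono _ _ nat int n n_incr). Qed.

Lemma n_nmono : {mono n : i j / (i < j)%N >-> i < j}.
Proof. exact: (@leW_mono _ _ nat int n n_mono). Qed.

Lemma len_gt0 i : 0 < len i.
Proof. by rewrite subr_gt0 n_nmono. Qed.

Lemma lenR_gt0 i : 0 < (len i)%:~R :> R.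
Proof. by rewrite ltr0z len_gt0. Qed.

Lemma n_ge i : i%:Z + n 0%N <= n i.
Proof. by elim: i => [|i IH]; [rewrite add0r|have := len_gt0 i; lia]. Qed.

Lemma interval_uniq (x : nat) i j :
  n i <= x%:Z < n i.+1 -> n j <= x%:Z < n j.+1 -> i = j.
Proof.
move=> /andP[ix xi] /andP[jx xj].
have := le_lt_trans ix xj; have := le_lt_trans jx xi; rewrite !n_nmono; lia.
Qed.

Lemma interval_density_ge0 A i : 0 <= interval_density R n A i.
Proof. by rewrite divr_ge0// ltW// lenR_gt0. Qed.

Lemma interval_nullP A : I A <->
  forall e : R, 0 < e -> exists N, forall i, (N <= i)%N ->
    interval_density R n A i < e.
Proof. exact/cvg0P/interval_density_ge0. Qed.

Lemma interval_density_le A B i : in_interval n A i #<= in_interval n B i ->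
  interval_density R n A i <= interval_density R n B i.
Proof.
move=> AB; rewrite ler_pM2r ?invr_gt0 ?lenR_gt0// ler_nat.
have /finite_setP[m Bm] := in_interval_finite n B i.
by rewrite (card_fset_set Bm) geq_card_fset_set// -(card_le_eqr Bm).
Qed.

Lemma interval_null_card_le A B :
  (forall i, in_interval n A i #<= in_interval n B i) -> I B -> I A.
Proof.
move=> AB /interval_nullP IB; apply/interval_nullP => e /IB[N BN].
by exists N => i /BN; apply: le_lt_trans; exact: interval_density_le.
Qed.

(* [|n i| + 2] bounds the number of points below the [i]-th interval, with room
   for its two end points. *)
Lemma below_interval_cvg0 :
  (`|n i|.+2%:R / (len i)%:~R : R) @[i --> \oo] --> (0 : R).
Proof.
(* The recurrence is [|n i.+1| + 2 <= (|n i| + 2) + len i], divided by [len i.+1]. *)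
apply: cvg0_contract n_lim => i.
- by rewrite divr_ge0// ltW// lenR_gt0.
- by rewrite divr_ge0// ltW// lenR_gt0.
rewrite mulrA ler_pM2r ?invr_gt0 ?lenR_gt0// mulrDl mul1r mulfVK ?gt_eqF ?lenR_gt0//.
have l0 := len_gt0 i.
rewrite -(ger0_norm (ltW (lenR_gt0 i))) -intr_norm -abszE -natrD ler_nat.
lia.
Qed.

Lemma interval_null_sparse A :
    (forall i, exists f : nat -> nat,
       in_interval n A i `<=` f @` `I_(`|n i|.+2)) ->
  I A.
Proof.
move=> Af; apply/interval_nullP => e e0.
have [|s0 _] := @cvg0P R (fun i => `|n i|.+2%:R / (len i)%:~R).
  by move=> i; rewrite divr_ge0// ltW// lenR_gt0.
have [N sN] := s0 below_interval_cvg0 _ e0.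
exists N => i /sN; apply: le_lt_trans.
rewrite ler_pM2r ?invr_gt0 ?lenR_gt0// ler_nat geq_card_fset_set//.
have [f Afi] := Af i.
exact: card_le_trans (subset_card_le Afi) (card_image_le _ _).
Qed.

Definition interval_union (B : set nat) : set nat :=
  [set k | exists2 i, B i & n i <= k%:Z < n i.+1].

Lemma almost_invariant_interval_union B : almost_invariant I (interval_union B).
Proof.
move=> p.
pose L := [set x : nat | exists2 i, n i <= x%:Z < n i.+1 & (p x)%:Z < n i].
pose U := [set x : nat | exists2 i, n i <= x%:Z < n i.+1 & n i.+1 <= (p x)%:Z].
have IL : I L.
  apply: interval_null_sparse => j; exists (p^-1)%g => x [[i xi pxi] xj].
  rewrite -(interval_uniq xi xj); exists (p x); last exact: SymK.
  by rewrite /=; lia.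
have IU : I U.
  (* The image is the sparse set: its points in interval [j] come from points below [n j]. *)
  suff : I (p @` U).
    move=> /(ideal_preimage p); apply: idealS; exact: preimage_image.
  apply: interval_null_sparse => j; exists p => _ [[x [i xi pxi] <-] /andP[_ pxj]].
  exists x => //=; have : n i.+1 < n j.+1 by apply: le_lt_trans pxi pxj.
  by rewrite n_nmono ltnS -n_mono; lia.
apply: idealS (idealU IL IU) => x [[i Bi xi] npx].
have [pxi|ipx] := ltP (p x)%:Z (n i); first by left; exists i.
have [pxi'|ipx'] := ltP (p x)%:Z (n i.+1); last by right; exists i.
by case: npx; exists i => //; rewrite ipx.
Qed.

(** When [n i] is nonnegative, every integer of the interval is a natural number. *)
Lemma interval_density_setT i : 0 <= n i -> 1 <= interval_density R n setT i.
Proof.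
move=> ni0; have l0 := len_gt0 i.
rewrite ler_pdivlMr ?lenR_gt0// mul1r.
rewrite -(ger0_norm (ltW (lenR_gt0 i))) -intr_norm -abszE ler_nat.
apply: leq_card_fset_set; first exact: in_interval_finite.
pose g k := (`|n i| + k)%N.
have gI : g @` `I_`|len i| `<=` in_interval n setT i.
  by move=> _ [k /= kl <-]; split=> //=; rewrite /g; lia.
apply: card_le_trans (subset_card_le gI).
by rewrite (card_le_eqr (inj_card_eq _))// => x y _ _ /addnI.
Qed.

Lemma n_eventually_ge0 i : (`|n 0%N| <= i)%N -> 0 <= n i.
Proof. by have := n_ge i; lia. Qed.

Lemma interval_nullNT : ~ I setT.
Proof.
move=> /interval_nullP/(_ 1 ltr01)[N /(_ (N + `|n 0%N|)%N (leq_addr _ _))].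
by rewrite ltNge interval_density_setT// n_eventually_ge0// leq_addl.
Qed.

Definition swap_adjacent (x : nat) : nat := if odd x then x.-1 else x.+1.

Lemma swap_adjacentK : involutive swap_adjacent.
Proof. by rewrite /swap_adjacent => -[//|x] /=; case: ifP => /=; case: ifP; lia. Qed.

Lemma swap_adjacent_neq x : swap_adjacent x <> x.
Proof. by rewrite /swap_adjacent; case: ifP; lia. Qed.

(** Only the first and last points of an interval can be swapped out of it; they form the sparse set
    [E]. Being an involution, the swap needs only one implication. *)
Lemma swap_adjacent_in_SymI : in_SymI I (mkSym (inv_bij swap_adjacentK)).
Proof.
suff imI A : I A -> I (swap_adjacent @` A).
  apply/asboolP => A; split => [/imI|]; last exact: imI.
  by rewrite image_comp (_ : _ \o _ = id) ?image_id//; exact/funext/swap_adjacentK.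
pose E := [set x : nat | exists i, x%:Z = n i \/ x.+1%:Z = n i].
have IE : I E.
  apply: interval_null_sparse => j.
  exists (fun k => if k is 0%N then `|n j|%N else `|n j.+1|.-1).
  move=> x [[i [xi|xi]] /andP[jx xj]].
    exists 0%N => //=; rewrite -(@interval_uniq x i j) ?jx ?xj//.
      by rewrite -xi.
    by rewrite xi lexx n_nmono leqnn.
  exists 1%N => //=.
  have : n j < n i <= n j.+1 by lia.
  rewrite n_nmono n_mono => /andP[ji ij].
  have -> : j.+1 = i by lia.
  by rewrite -xi; lia.
move=> IA; suff IB : I (swap_adjacent @` A `\` E).
  apply: idealS (idealU IB IE) => x Ax.
  by have [Ex|nEx] := pselect (E x); [right|left].
apply: interval_null_card_le IA => j.
apply: card_le_trans (card_image_le swap_adjacent _).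
apply: subset_card_le => _ [[[x Ax <-] nEx] /andP[jx xj]].
exists x => //; split=> //=.
have n1 : (swap_adjacent x)%:Z <> n j by move=> xE; apply: nEx; exists j; left.
have n2 : (swap_adjacent x).+1%:Z <> n j.+1.
  by move=> xE; apply: nEx; exists j.+1; right.
by move: n1 n2 jx xj; rewrite /swap_adjacent; case: ifP; lia.
Qed.

Lemma support_swap_adjacent : ~ I (Defs.support (mkSym (inv_bij swap_adjacentK))).
Proof.
move=> Is; apply: interval_nullNT; apply: idealS Is => x _.
exact: swap_adjacent_neq.
Qed.

Lemma not_interval_null_infinite A : ~ I A ->
  exists2 e : R, 0 < e &
    infinite_set [set i | e <= interval_density R n A i /\ 0 <= n i].
Proof.
move=> nIA; apply: contrapT => nex; apply: nIA; apply/interval_nullP => e e0.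
apply: contrapT => nN; apply: nex; exists e => // fin.
have [N Nub] : exists N, forall i, e <= interval_density R n A i /\ 0 <= n i ->
    (i < N)%N.
  have [s sE] := (finite_seqP _).1 fin.
  exists (\max_(i <- s) i).+1 => i Ji; rewrite ltnS.
  have si : [set` s] i by rewrite -sE.
  exact: (leq_bigmax_seq (F := id)).
apply: nN; exists (N + `|n 0%N|)%N => i Ni; rewrite ltNge; apply/negP => ei.
have : (i < N)%N.
  by apply: Nub; split=> //; apply: n_eventually_ge0; lia.
lia.
Qed.

(* A nontrivial element [h] moves a fixed proportion of infinitely many
   intervals [b k]. These are split into one infinite block for each natural
   number, and a last block supplying the infinite null set [Z]. *)
Lemma card_maximal_abelian_interval (h : SymI I)
    (H : set (quotient_group (FinI I))) :
  maximal_abelian_subgroup H -> H (\pi_(quotient_group (FinI I)) h)%qT ->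
  ~ I (Defs.support h) -> [set: set nat] #<= H.
Proof.
move=> maxH Hh /not_interval_null_infinite[e e0].
set J := [set i | _] => /infiniteP/pcard_leP[b].
have bJ k : J (b k) by exact: funS.
have binj : injective b by move=> x y; apply: inj; rewrite inE.
(* [inl (k, m)] indexes the [m]-th interval of block [k], and [inr k] an interval reserved for
   [Z]. *)
pose c (u : nat * nat + nat) : nat := b (choice.pickle u).
have cinj : injective c by move=> u v /binj; exact: (pcan_inj choice.pickleK).
have cJ u : J (c u) by exact: bJ.
pose B (S : set nat) := [set i | exists k m, S k /\ i = c (inl (k, m))].
pose z k := `|n (c (inr k))|%N.
have zE k : (z k)%:Z = n (c (inr k)) by have [_] := cJ (inr k); rewrite /z; lia.
have zint k : n (c (inr k)) <= (z k)%:Z < n (c (inr k)).+1.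
  by rewrite zE lexx n_nmono leqnn.
apply: (@card_maximal_abelian _ h H (fun S => interval_union (B S)) (range z)) => //.
- apply/infiniteP; rewrite (card_le_eqr (inj_card_eq _))// => k l _ _ zkl.
  have := zint k; rewrite zkl => /(interval_uniq (zint l))/cinj; by case.
- apply: interval_null_sparse => j; exists (fun=> `|n j|%N).
  move=> _ [[k _ <-] zj]; exists 0%N => //.
  by rewrite -(interval_uniq (zint k) zj).
- move=> S; apply/seteqP; split => // _ [[k _ <-] [i [l [m [_ ->]]]]].
  by move=> /(interval_uniq (zint k))/cinj.
- by move=> S; exact: almost_invariant_interval_union.
move=> S S' /existsNP[k /not_implyP[Sk nS'k]] /interval_nullP/(_ _ e0)[N].
(* Block [k] is infinite, so it has an interval beyond [N]; that interval lies in [X S] and misses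
   [X S']. *)
have [|m Nm /(_ _ (ltnW Nm))] := @injective_gtn (fun m => c (inl (k, m))) _ N.
  by move=> m m' /cinj[].
rewrite ltNge => /negP; apply; have [ej _] := cJ (inl (k, m)).
apply: le_trans ej _; apply/interval_density_le/subset_card_le => x [hx xi].
split=> //; split=> //; split; first by exists (c (inl (k, m))) => //; exists k, m.
move=> [_ [k' [m' [S'k' ->]]]] /(interval_uniq xi)/cinj[kk' _].
by apply: nS'k; rewrite kk'.
Qed.

End IntervalNull.

Theorem theorem6p1 (R : realType) (n : nat -> int)
    (n_incr : {homo n : i j / (i < j)%N >-> i < j})
    (n_lim : ((n i.+1 - n i)%:~R / (n i.+2 - n i.+1)%:~R : R) @[i --> \oo]
       --> (0 : R)) :
  ideal_abelian_number_eq (interval_ideal R n) [set: set nat].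
Proof.
split; first exact: set_nat_uncountable.
  pose p := MkSymI (swap_adjacent_in_SymI n_incr n_lim).
  have [H maxH Hp] :=
    maximal_abelian_exists (\pi_(quotient_group (FinI (interval_ideal R n))) p)%qT.
  exists H => //; rewrite card_eq_le; apply/andP; split.
    exact: card_le_trans (card_leT H) (card_quotient_SymI _).
  apply: card_maximal_abelian_interval maxH Hp _ => //.
  exact: support_swap_adjacent.
move=> U l ncl [H maxH Hl]; rewrite -(card_le_eqr Hl).
(* An uncountable [H] is not trivial, so it contains a class whose representative has support
   outside the ideal. *)
have [Hone|] := pselect (H `<=` [set 1%g]).
  case: ncl; rewrite -(eq_countable Hl); apply: finite_set_countable.
  exact: sub_finite_set Hone (finite_set1 _).
move=> /existsNP[c /not_implyP[Hc c1]].
rewrite -[c]reprK in Hc; apply: card_maximal_abelian_interval maxH Hc _ => //.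
by move=> Ic; apply: c1; rewrite -[c]reprK; apply/(pi_SymI_eq _ 1%g).
Qed.
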